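(* Let $\mathcal S=\Phi(\Omega)$ be an $\mathbb H^1$-regular surface represented as an $X$-graph of a continuous function $\phi:\Omega\to\mathbb R$, let $\rho$ be a homogeneous norm on $\mathbb H^1$, and let $\Omega'\Subset\Omega$ (notation as in the context). Then for $(A,B)\in D(\Omega')$, $$|d_{g,\rho}(A,B)-\tilde d_\rho(A,B)|=o\big(d_{g,\rho}(A,B)\big),$$ where the $o$ is uniform as $A\to B$ (that is: for every $\varepsilon>0$ there is $\delta>0$ such that the left side is at most $\varepsilon\,d_{g,\rho}(A,B)$ for all $(A,B)\in D(\Omega')$ with $|A-B|<\delta$, whatever the choice of integral curve in the definition of $d_{g,\rho}$).
   Context: The Heisenberg group $\mathbb H^1$ is $\mathbb R^3$ with the law $(x,y,z)(x',y',z')=(x+x',y+y',z+z'+2x'y-2xy')$, dilations $\delta_t(x,y,z)=(tx,ty,t^2z)$, and left-invariant horizontal vector fields $X=\partial_x+2y\partial_z$, $Y=\partial_y-2x\partial_z$. A homogeneous norm $\rho$ is a continuous function $\rho\ge0$ on $\mathbb H^1$, vanishing only at $0$, with $\rho(A^{-1})=\rho(A)$, $\rho(\delta_tA)=t\rho(A)$ for $t>0$, and $\rho(AB)\le c(\rho(A)+\rho(B))$ for some $c\ge1$. A function $f:\mathbb H^1\to\mathbb R$ is of class $C^1_H$ if at every $A$ there is a continuous group homomorphism $L=D_hf(A):\mathbb H^1\to\mathbb R$ with $L(\delta_tB)=tL(B)$ and $f(AB)-f(A)-L(B)=o(\rho(B))$ as $B\to0$, depending continuously on $A$. Setting: $f\in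 C^1_H(\mathbb H^1,\mathbb R)$ with $f(0)=0$ and $Xf(0)\neq0$; $U$ is a neighbourhood of $0$ on which $Xf\ne0$, $\Omega\subset\mathbb R^2$ is open, and $\phi:\Omega\to\mathbb R$ is continuous with $$\mathcal S:=f^{-1}(0)\cap U=\{\Phi(y,z):(y,z)\in\Omega\},\qquad \Phi(y,z):=(0,y,z)(\phi(y,z),0,0)=(\phi(y,z),\,y,\,z+2\phi(y,z)y),$$ $\Phi$ being a homeomorphism of $\Omega$ onto $\mathcal S$. Put $w=-\frac{Yf}{Xf}\circ\Phi$, $W^\phi=\partial_y-4\phi\,\partial_z$ on $\Omega$, and $\tilde d_\rho(A,B)=\rho(\Phi(A)^{-1}\Phi(B))$ for $A,B\in\Omega$. For $A=(y_1,z_1)$, $B=(y_2,z_2)\in\Omega$, fix any integral curve $\gamma_1(t)=(y_1+t,z_1(t))$ of $W^\phi$ (maximal in $\Omega$, defined on an interval $I_{\gamma_1}$) with $\gamma_1(0)=A$. If the interval between $0$ and $y_2-y_1$ is contained in $I_{\gamma_1}$, put $\hat z_1=z_1(y_2-y_1)$ and $$d_{g,\rho}(A,B):=\rho\big(w(A)(y_2-y_1),\ y_2-y_1,\ z_2-\hat z_1\big).$$ $D(\Omega')\subset\Omega'\times\Omega'$ is the set of pairs $(A,B)$ for which $d_{g,\rho}(A,B)$ can be defined. $\Omega'\Subset\Omega$ means that $\Omega'$ has compact closure in $\Omega$. *)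

(* Defs.v *)
From HB Require Import structures.
From mathcomp Require Import all_boot all_order all_algebra.
From mathcomp Require Import all_classical all_reals all_analysis.

Set Implicit Arguments.
Unset Strict Implicit.
Unset Printing Implicit Defensive.

Import Order.TTheory GRing.Theory Num.Theory.
Import numFieldNormedType.Exports.

Local Open Scope classical_set_scope.
Local Open Scope ring_scope.

(* The additive structure and the topology are those of R^3 and R^2; the group
   law of the Heisenberg group is [hmul] below, not the addition. *)
Notation heis R := (R * R * R)%type.
Notation plane R := (R * R)%type.

Section Heisenberg.
Context {R : realType}.
Implicit Types (A B p : heis R) (f rho L : heis R -> R).

Definition hmul A B : heis R :=
  (A.1.1 + B.1.1, A.1.2 + B.1.2,
   A.2 + B.2 + 2 * (B.1.1 * A.1.2) - 2 * (A.1.1 * B.1.2)).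

Definition hinv A : heis R := (- A.1.1, - A.1.2, - A.2).

Definition dil (t : R) A : heis R := (t * A.1.1, t * A.1.2, t ^+ 2 * A.2).

Record homogeneous_norm rho : Prop := HomogeneousNorm {
  hnorm_continuous : continuous rho;
  hnorm_ge0 : forall A, 0 <= rho A;
  hnorm_eq0 : forall A, rho A = 0 <-> A = 0;
  hnorm_inv : forall A, rho (hinv A) = rho A;
  hnorm_dil : forall t A, 0 < t -> rho (dil t A) = t * rho A;
  hnorm_mul : exists2 c : R, 1 <= c &
    forall A B, rho (hmul A B) <= c * (rho A + rho B) }.

Record homogeneous_hom L : Prop := HomogeneousHom {
  hhom_continuous : continuous L;
  hhom_mul : forall A B, L (hmul A B) = L A + L B;
  hhom_dil : forall t A, 0 < t -> L (dil t A) = t * L A }.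

Definition hdiff rho f A L : Prop :=
  homogeneous_hom L /\
  (fun B => f (hmul A B) - f A - L B) =o_ (nbhs (0 : heis R)) rho.

(* All homogeneous norms are equivalent, so the notion does not depend on
   [rho].  The differential depends continuously on the point for the norm
   sup_(B != 0) |L B| / rho B on homogeneous homomorphisms. *)
Definition C1H rho f : Prop :=
  exists Df : heis R -> heis R -> R,
    (forall A, hdiff rho f A (Df A)) /\
    (forall A (e : R), 0 < e ->
       \forall A' \near A, forall B, `|Df A' B - Df A B| <= e * rho B).

Definition Xvec A : heis R := (1, 0, 2 * A.1.2).
Definition Yvec A : heis R := (0, 1, - 2 * A.1.1).

(* A + t *: Xvec A = hmul A (t, 0, 0) and A + t *: Yvec A = hmul A (0, t, 0),
   so these directional derivatives are the derivatives of f along the integral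
   curves of X and Y; they make sense for f that is not differentiable in the
   Euclidean sense. *)
Definition Xder f A : R := 'D_(Xvec A) f A.
Definition Yder f A : R := 'D_(Yvec A) f A.

End Heisenberg.

Definition homeomorphism_onto {S T : topologicalType} (D : set S) (E : set T)
    (g : S -> T) : Prop :=
  set_bij D E g /\ {within D, continuous g} /\
  exists h : T -> S, (forall x, D x -> h (g x) = x) /\ {within E, continuous h}.

Section Curves.
Context {R : realType}.
Implicit Types (V : plane R -> plane R) (Omega : set (plane R)).

(* Integral curves are parametrized by open intervals: a maximal integral curve
   of a continuous vector field on an open set always is.  Only the values of
   [gamma] on [I] are meaningful. *)
Definition integral_curve V Omega (I : set R) (gamma : R -> plane R) : Prop :=
  [/\ open I, is_interval I, (forall t, I t -> Omega (gamma t)) &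
      forall t, I t -> is_derive t 1 gamma (V (gamma t))].

Definition maximal_integral_curve V Omega (I : set R) (gamma : R -> plane R) :
    Prop :=
  integral_curve V Omega I gamma /\
  forall (J : set R) (eta : R -> plane R), integral_curve V Omega J eta ->
    I `<=` J -> (forall t, I t -> eta t = gamma t) -> J = I.

End Curves.

Section Graph.
Context {R : realType}.
Implicit Types (rho f : heis R -> R) (phi w : plane R -> R) (A B : plane R).

Definition graph_map phi (p : plane R) : heis R :=
  hmul (0, p.1, p.2) (phi p, 0, 0).

Definition Wvec phi (p : plane R) : plane R := (1, - 4 * phi p).

Definition graph_slope f phi (p : plane R) : R :=
  - (Yder f (graph_map phi p) / Xder f (graph_map phi p)).

Definition dtilde rho phi A B : R :=
  rho (hmul (hinv (graph_map phi A)) (graph_map phi B)).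

(* [is_dg rho phi w Omega A B d] : [d] is a value of d_(g,rho)(A,B), for some
   choice of the maximal integral curve of W^phi through A.  As the first
   component of [Wvec phi] is 1, the curve is (A.1 + t, z1 t). *)
Definition is_dg rho phi w (Omega : set (plane R)) A B (d : R) : Prop :=
  exists (I : set R) (gamma : R -> plane R),
    [/\ maximal_integral_curve (Wvec phi) Omega I gamma,
        I 0 /\ gamma 0 = A,
        `[Num.min 0 (B.1 - A.1), Num.max 0 (B.1 - A.1)] `<=` I &
        d = rho (w A * (B.1 - A.1), B.1 - A.1, B.2 - (gamma (B.1 - A.1)).2)].

Definition dg_domain rho phi w (Omega Omega' : set (plane R)) :
    set (plane R * plane R) :=
  [set AB | [/\ Omega' AB.1, Omega' AB.2 &
                exists d, is_dg rho phi w Omega AB.1 AB.2 d]].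

End Graph.

Definition compactly_contained {T : topologicalType} (D E : set T) : Prop :=
  compact (closure D) /\ closure D `<=` E.

(* Main.v *)
(* Write N for the gauge max(|x|, |y|, |z|^(1/2)).  Moving along six horizontal
   segments and using the mean value theorem on each, the Pansu differential of
   f is uniform on compact sets; since f vanishes on the graph and Xf does not,
   this gives phi(B) - phi(A) = w(A) (y2 - y1) + o(N), where N is the gauge of
   Phi(A)^-1 Phi(B).  Feeding this back into the equation of an integral curve
   of W^phi through A shows first that the gauge between A and the point C of
   the curve above y2 is O(|y2 - y1|), and then that the vertical component of
   Phi(A)^-1 Phi(C) is o(|y2 - y1|^2), because the second order terms cancel.
   Hence Phi(A)^-1 Phi(B) and (w(A) (y2 - y1), y2 - y1, z2 - z1hat) differ by
   o(N), 0 and o(N^2) in the three coordinates, and homogeneity of rho turns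
   this into a difference o(N) of their norms. *)

Require Import Defs.
From HB Require Import structures.
From mathcomp Require Import all_boot all_order all_algebra.
From mathcomp Require Import all_classical all_reals all_analysis.
From mathcomp Require Import ring lra.

Set Implicit Arguments.
Unset Strict Implicit.
Unset Printing Implicit Defensive.

Import Order.TTheory GRing.Theory Num.Theory.
Import numFieldNormedType.Exports.

Local Open Scope classical_set_scope.
Local Open Scope ring_scope.

(** * Uniformity over compact sets *)

Section Compactness.
Context {R : realType} {V : normedModType R}.
Implicit Types K : set V.

(** A Lebesgue number argument: halving the local radius keeps [y] in the ball around [x] when the
    base point moves, and compactness then leaves a single radius. The second point may lie outside
    [K]. *)
Lemma compact_uniform_near K (P : V -> V -> Prop) : compact K ->
  (forall x, K x -> exists2 r : R, 0 < r &
     forall y z, `|x - y| < r -> `|x - z| < r -> P y z) ->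
  exists2 r : R, 0 < r & forall x y, K x -> `|x - y| < r -> P x y.
Proof.
move=> /compact_near_coveringP cK KP.
have /cK nK : forall x, K x -> \forall x' \near x & r \near (0 : R)^'+,
    forall y, `|x' - y| < r -> P x' y.
  move=> x /KP [r r0 Pr].
  exists (ball x (r / 2), [set e | 0 < e < r / 2]).
    split; first by apply: nbhsx_ballx; lra.
    by near=> e => /=; apply/andP; split; near: e;
      [exact: nbhs_right_gt|apply: nbhs_right_lt; lra].
  move=> [x' e] /= [] ; rewrite -ball_normE /= => xx' /andP[e0 er] y x'y.
  apply: Pr; first by lra.
  have := ler_normD (x - x') (x' - y); rewrite addrA subrK; lra.
near (0 : R)^'+ => r; exists r; first by near: r; exact: nbhs_right_gt.
have rP : K `<=` fun x => forall y, `|x - y| < r -> P x y by near: r; exact: nK.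
by move=> x y /rP; exact.
Unshelve. all: by end_near. Qed.

(** Heine-Cantor with [y] allowed to leave [K]; hence continuity is assumed in the ambient space at
    the points of [K], not within [K]. *)
Lemma compact_uniform_continuous K (u : V -> R) : compact K ->
  (forall x, K x -> {for x, continuous u}) ->
  forall e : R, 0 < e -> exists2 r : R, 0 < r &
    forall x y, K x -> `|x - y| < r -> `|u x - u y| < e.
Proof.
move=> cK cu e e0; apply: compact_uniform_near => // x Kx.
have /cvgrPdist_lt /(_ (e / 2)) := cu x Kx.
case/(_ _)/nbhs_ballP => [|r /= r0 ru]; first by lra.
exists r => // y z xy xz.
have := ru y; have := ru z; rewrite -ball_normE /= => /(_ xz) uz /(_ xy) uy.
have := ler_normD (u y - u x) (u x - u z).
rewrite addrA subrK (distrC (u y) (u x)); lra.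
Qed.

Lemma compact_continuous_bounded K (u : V -> R) : compact K ->
  (forall x, K x -> {for x, continuous u}) ->
  exists2 M : R, 0 < M & forall x, K x -> `|u x| <= M.
Proof.
move=> cK cu.
have /compact_bounded[M [_ uM]] : compact (u @` K).
  by apply: continuous_compact => //; apply: continuous_in_subspaceT => x /set_mem /cu.
exists (`|M| + 1) => [|x Kx]; first by have := normr_ge0 M; lra.
by apply: uM; [have := ler_norm M; lra|exists x].
Qed.

End Compactness.

(** * The mean value theorem on closed intervals of either orientation *)

Section MeanValue.
Context {R : realType}.
Implicit Types F dF : R -> R.

Lemma MVT_closed F dF (a b : R) : a <= b ->
  (forall t, a <= t <= b -> is_derive t 1 F (dF t)) ->
  exists2 c, a <= c <= b & F b - F a = dF c * (b - a).
Proof.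
move=> ab dFP.
have [||c] := @MVT_segment R F dF a b ab; last by rewrite in_itv /=; exists c.
- by move=> x; rewrite in_itv /= => /andP[ax xb]; apply: dFP; rewrite !ltW.
- apply: continuous_in_subspaceT => x /set_mem /=; rewrite in_itv /= => xab.
  apply: differentiable_continuous; apply/derivable1_diffP.
  by case: (dFP x xab).
Qed.

Lemma MVT_origin F dF (s : R) : (forall t : R, is_derive t 1 F (dF t)) ->
  exists2 c, `|c| <= `|s| & F s - F 0 = dF c * s.
Proof.
move=> dFP; have [s0|s0] := leP 0 s.
  have [c /andP[c0 cs] E] := MVT_closed s0 (fun t _ => dFP t).
  by exists c; rewrite ?ger0_norm // E subr0.
have [c /andP[c0 cs] E] := MVT_closed (ltW s0) (fun t _ => dFP t).
exists c; first by rewrite !ler0_norm ?lerN2 // ltW.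
by rewrite -opprB E sub0r mulrN opprK.
Qed.

End MeanValue.

Lemma pair_continuous_at (S T1 T2 : topologicalType) (f : S -> T1) (g : S -> T2)
    (x : S) : {for x, continuous f} -> {for x, continuous g} ->
  {for x, continuous (fun t => (f t, g t))}.
Proof. by move=> cf cg; apply: cvg_pair. Qed.

(** * Derivatives of [f] along horizontal lines *)

Section HorizontalDerivatives.
Context {R : realType}.
Implicit Types (A Q : heis R) (f rho L : heis R -> R) (a b s t : R).

Lemma hinv_horizontal a b : hinv ((a, b, 0) : heis R) = (- a, - b, 0).
Proof. by rewrite /hinv /= oppr0. Qed.

Lemma dil_horizontal s a b : dil s ((a, b, 0) : heis R) = (s * a, s * b, 0).
Proof. by rewrite /dil /= mulr0. Qed.

Lemma hmul0 A : hmul A 0 = A.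
Proof. by case: A => [[x y] z]; rewrite /hmul /=; congr (_, _, _); ring. Qed.

(** Multiples of one horizontal vector form a one-parameter subgroup, because the vertical term of
    the law is antisymmetric. A derivative at time [t] thus becomes a derivative at time 0 from a
    moved base point. *)
Lemma hmul_horizontalD Q a b s t :
  hmul (hmul Q (t * a, t * b, 0)) (s * a, s * b, 0) =
  hmul Q ((s + t) * a, (s + t) * b, 0).
Proof.
by case: Q => [[x y] z]; rewrite /hmul /=; congr (_, _, _); ring.
Qed.

(** Dilations only cover [s > 0]; for negative [s] the inverse of a horizontal element supplies the
    sign. *)
Lemma hnorm_horizontal rho a b s : homogeneous_norm rho ->
  rho (s * a, s * b, 0) = `|s| * rho (a, b, 0).
Proof.
move=> hr; case: (ltrgtP s 0) => [s0|s0|->].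
- rewrite ltr0_norm // -[in RHS](hnorm_dil hr) ?oppr_gt0 // dil_horizontal.
  by rewrite -[LHS](hnorm_inv hr) hinv_horizontal !mulNr.
- by rewrite gtr0_norm // -(hnorm_dil hr) // dil_horizontal.
- by rewrite !mul0r normr0 mul0r; apply/(hnorm_eq0 hr).
Qed.

Lemma hhom_horizontal L a b s : homogeneous_hom L ->
  L (s * a, s * b, 0) = s * L (a, b, 0).
Proof.
move=> hL; have L0 : L 0 = 0.
  by have := hhom_mul hL 0 0; rewrite hmul0; lra.
case: (ltrgtP s 0) => [s0|s0|->].
- have := hhom_mul hL (s * a, s * b, 0) ((- s) * a, (- s) * b, 0).
  rewrite -(dil_horizontal (- s)) (hhom_dil hL) ?oppr_gt0 // dil_horizontal.
  have -> : hmul (s * a, s * b, 0) (- s * a, - s * b, 0) = 0 :> heis R.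
    by rewrite /hmul /=; congr (_, _, _); ring.
  rewrite L0; lra.
- by rewrite -(hhom_dil hL) // dil_horizontal.
- by rewrite !mul0r L0.
Qed.

(** On a horizontal line [rho] and [L] are homogeneous of degree one in [h], so the remainder
    o([rho]) is o([h]) and the difference quotient converges. *)
Lemma hdiff_horizontal_cvg rho f A L a b : homogeneous_norm rho ->
  hdiff rho f A L ->
  (fun h : R => h^-1 *: (f (hmul A (h * a, h * b, 0)) - f A)) @ 0^' -->
  L (a, b, 0).
Proof.
move=> hr [hL /eqoP fo]; apply/cvgrPdist_le => e e0.
set r := rho (a, b, 0); have r0 : 0 <= r by exact: hnorm_ge0.
(* The 1 in the denominator covers the case [r = 0]. *)
have er : 0 < e / (r + 1) by rewrite divr_gt0 //; lra.
have cv : (fun h : R => (h * a, h * b, 0) : heis R) @ 0 --> (0 : heis R).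
  have : {for 0, continuous (fun h : R => (h * a, h * b, 0) : heis R)}.
    apply: pair_continuous_at; last exact: cst_continuous.
    by apply: pair_continuous_at; exact: mulrr_continuous.
  by rewrite /prop_for /continuous_at !mul0r.
have := cv _ (fo _ er); rewrite /= nearE => nh.
have : \forall h \near (0 : R)^', h != 0 by exact: nbhs_dnbhs_neq.
have : \forall h \near (0 : R)^', `|f (hmul A (h * a, h * b, 0)) - f A -
   L (h * a, h * b, 0)| <= e / (r + 1) * `|rho (h * a, h * b, 0)| by exact: nbhs_dnbhs.
apply: filterS2 => h H h0; move: H.
rewrite (hnorm_horizontal _ _ _ hr) (hhom_horizontal _ _ _ hL) -/r.
rewrite (ger0_norm (mulr_ge0 _ _)) ?normr_ge0 // => H.
rewrite distrC; have -> : h^-1 *: (f (hmul A (h * a, h * b, 0)) - f A) - L (a, b, 0) =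
  h^-1 * (f (hmul A (h * a, h * b, 0)) - f A - h * L (a, b, 0)).
  by rewrite /GRing.scale /=; field.
rewrite normrM normfV ler_pdivrMl ?normr_gt0 //; apply: le_trans H _.
rewrite mulrCA ler_pM2l ?normr_gt0 // mulrAC ler_pdivrMr; last by lra.
by rewrite ler_pM2l //; lra.
Qed.

Lemma is_derive_horizontal rho f (Df : heis R -> heis R -> R) Q a b t :
  homogeneous_norm rho -> (forall A, hdiff rho f A (Df A)) ->
  is_derive t 1 (fun s => f (hmul Q (s * a, s * b, 0)))
    (Df (hmul Q (t * a, t * b, 0)) (a, b, 0)).
Proof.
move=> hr fD.
have := hdiff_horizontal_cvg (a := a) (b := b) hr (fD (hmul Q (t * a, t * b, 0))).
under eq_fun do rewrite hmul_horizontalD.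
move=> cv.
have E : (fun h : R => h^-1 *:
    (((fun s => f (hmul Q (s * a, s * b, 0))) \o shift t) (h *: (1 : R)) -
     f (hmul Q (t * a, t * b, 0)))) @ 0^' -->
    Df (hmul Q (t * a, t * b, 0)) (a, b, 0).
  by under eq_fun do rewrite /= /GRing.scale /= mulr1.
by split; [exact: cvgP E|exact: cvg_lim E].
Qed.

Lemma Xder_hdiff rho f A L : homogeneous_norm rho -> hdiff rho f A L ->
  Xder f A = L (1, 0, 0).
Proof.
move=> hr fD; apply: cvg_lim => //.
apply: cvg_trans (hdiff_horizontal_cvg (a := 1) (b := 0) hr fD).
apply: near_eq_cvg; apply: nearW => h /=; congr (_ *: (f _ - _)).
case: A {fD} => [[x y] z]; rewrite /Xvec /hmul /=.
by congr (_, _, _); rewrite /= /GRing.scale /=; ring.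
Qed.

Lemma Yder_hdiff rho f A L : homogeneous_norm rho -> hdiff rho f A L ->
  Yder f A = L (0, 1, 0).
Proof.
move=> hr fD; apply: cvg_lim => //.
apply: cvg_trans (hdiff_horizontal_cvg (a := 0) (b := 1) hr fD).
apply: near_eq_cvg; apply: nearW => h /=; congr (_ *: (f _ - _)).
case: A {fD} => [[x y] z]; rewrite /Yvec /hmul /=.
by congr (_, _, _); rewrite /= /GRing.scale /=; ring.
Qed.

(** All that is used of [C1H] afterwards. Continuity of the differential in operator norm gives
    continuity of [Df A V] for each fixed [V], and [Xder], [Yder] are its values at the two
    horizontal unit vectors. *)
Lemma C1H_horizontal rho f : homogeneous_norm rho -> C1H rho f ->
  [/\ continuous (Xder f), continuous (Yder f),
    (forall Q t, is_derive t 1 (fun s => f (hmul Q (s, 0, 0)))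
       (Xder f (hmul Q (t, 0, 0)))) &
    (forall Q t, is_derive t 1 (fun s => f (hmul Q (0, s, 0)))
       (Yder f (hmul Q (0, t, 0))))].
Proof.
move=> hr [Df [fD Dfc]].
have c V : continuous (fun A => Df A V).
  move=> A; apply/cvgrPdist_le => e e0; have r0 := hnorm_ge0 hr V.
  have er : 0 < e / (rho V + 1) by rewrite divr_gt0 //; lra.
  apply: filterS (Dfc A _ er) => A' /(_ V); rewrite distrC => H.
  apply: le_trans H _; rewrite mulrAC ler_pdivrMr; last by lra.
  by rewrite ler_pM2l //; lra.
have EX : Xder f = fun A => Df A (1, 0, 0).
  by apply/funext => A; exact: Xder_hdiff (fD A).
have EY : Yder f = fun A => Df A (0, 1, 0).
  by apply/funext => A; exact: Yder_hdiff (fD A).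
rewrite EX EY; split=> // Q t.
- have := is_derive_horizontal Q 1 0 t hr fD.
  by under eq_fun do rewrite mulr1 mulr0; rewrite mulr1 mulr0.
- have := is_derive_horizontal Q 0 1 t hr fD.
  by under eq_fun do rewrite mulr1 mulr0; rewrite mulr1 mulr0.
Qed.

End HorizontalDerivatives.

(** * The gauge and its behaviour under the group law *)

Section Gauge.
Context {R : realType}.
Implicit Types (A P Q U V : heis R) (f rho : heis R -> R) (n s t : R).

Definition hgauge V : R :=
  Num.max (Num.max `|V.1.1| `|V.1.2|) (Num.sqrt `|V.2|).

Lemma hgauge_coords V :
  [/\ `|V.1.1| <= hgauge V, `|V.1.2| <= hgauge V & `|V.2| <= hgauge V ^+ 2].
Proof.
split; rewrite ?/hgauge ?le_max ?lexx ?orbT //.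
rewrite -[leLHS]sqr_sqrtr // ler_sqr ?nnegrE ?sqrtr_ge0 ?le_max ?lexx ?orbT //.
by rewrite sqrtr_ge0 orbT.
Qed.

Lemma hgauge_le V n : 0 <= n -> `|V.1.1| <= n -> `|V.1.2| <= n ->
  `|V.2| <= n ^+ 2 -> hgauge V <= n.
Proof.
move=> n0 h1 h2 h3; rewrite /hgauge !ge_max h1 h2 /=.
by rewrite -[leRHS](ger0_norm n0) -(sqrtr_sqr n) ler_sqrt // sqr_ge0.
Qed.

Lemma hgauge_ge0 V : 0 <= hgauge V.
Proof. by have [h _ _] := hgauge_coords V; apply: le_trans h. Qed.

Lemma hgauge_dil t V : 0 < t -> hgauge (dil t V) = t * hgauge V.
Proof.
move=> t0; rewrite /hgauge /dil /= (normrM _ V.2) normrX !normrM (gtr0_norm t0).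
rewrite sqrtrM ?sqr_ge0 // sqrtr_sqr (gtr0_norm t0).
by rewrite !maxr_pMr ?ltW.
Qed.

Lemma heis_norm_le V n : `|V.1.1| <= n -> `|V.1.2| <= n -> `|V.2| <= n ->
  `|V| <= n.
Proof. by move=> h1 h2 h3; rewrite !ge_max h1 h2 h3. Qed.

Lemma hgauge_norm V : hgauge V <= 1 -> `|V| <= hgauge V.
Proof.
move=> N1; have [h1 h2 h3] := hgauge_coords V; have N0 := hgauge_ge0 V.
by apply: heis_norm_le => //; nra.
Qed.

(** With u, v the two gauges, the vertical part is at most u^2 + v^2 + 4uv, which is below (u +
    2v)^2. The factor 2 falls on the right factor only, so it does not compound along a chain of
    moves. *)
Lemma hgauge_hmul U V : hgauge (hmul U V) <= hgauge U + 2 * hgauge V.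
Proof.
have [u1 u2 u3] := hgauge_coords U; have [v1 v2 v3] := hgauge_coords V.
have u0 := hgauge_ge0 U; have v0 := hgauge_ge0 V.
apply: hgauge_le; first lra.
- by have := ler_normD U.1.1 V.1.1; rewrite /=; lra.
- by have := ler_normD U.1.2 V.1.2; rewrite /=; lra.
have h1 : `|2 * (V.1.1 * U.1.2)| <= 2 * (hgauge U * hgauge V).
  by rewrite normrM (@ger0_norm _ 2) // ler_pM2l // mulrC normrM ler_pM.
have h2 : `|2 * (U.1.1 * V.1.2)| <= 2 * (hgauge U * hgauge V).
  by rewrite normrM (@ger0_norm _ 2) // ler_pM2l // normrM ler_pM.
move: u3 v3 h1 h2; rewrite /= !ler_norml => /andP[? ?] /andP[? ?] /andP[? ?] /andP[? ?].
by apply/andP; split; nra.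
Qed.

Lemma hgauge_horizontal s : hgauge (s, 0, 0) = `|s| /\ hgauge (0, s, 0) = `|s|.
Proof.
by rewrite /hgauge /= normr0 sqrtr0 !(max_r (normr_ge0 s)) !(max_l (normr_ge0 s)).
Qed.

Lemma hmulA P Q U : hmul P (hmul Q U) = hmul (hmul P Q) U.
Proof.
case: P Q U => [[? ?] ?] [[? ?] ?] [[? ?] ?].
by rewrite /hmul /=; congr (_, _, _); ring.
Qed.

Lemma hmul_dist P V : `|P - hmul P V| <= (1 + 4 * `|P|) * `|V|.
Proof.
have P1 : `|P.1.1| <= `|P| by rewrite le_max le_max lexx.
have P2 : `|P.1.2| <= `|P| by rewrite le_max le_max lexx orbT.
have V1 : `|V.1.1| <= `|V| by rewrite le_max le_max lexx.
have V2 : `|V.1.2| <= `|V| by rewrite le_max le_max lexx orbT.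
have V3 : `|V.2| <= `|V| by rewrite le_max lexx orbT.
have P0 : 0 <= `|P| by []. have V0 : 0 <= `|V| by [].
have h1 : `|V.1.1 * P.1.2| <= `|P| * `|V| by rewrite normrM mulrC ler_pM.
have h2 : `|P.1.1 * V.1.2| <= `|P| * `|V| by rewrite normrM ler_pM.
move: V1 V2 V3 h1 h2; move: `|P| `|V| P0 V0 => p v p0 v0.
rewrite !ler_norml => /andP[? ?] /andP[? ?] /andP[? ?] /andP[? ?] /andP[? ?].
by apply: heis_norm_le; rewrite /= ler_norml; apply/andP; split; nra.
Qed.

End Gauge.

(** * Pansu differentiability, uniform on compact sets *)

Section UniformDifferentiability.
Context {R : realType}.
Implicit Types (A P Q U V : heis R) (f rho : heis R -> R).

(** -4ab is the vertical component of the commutator of [(a, 0, 0)] and [(0, b, 0)]; taking both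
    sides of equal length makes them of order the square root of [c]. *)
Lemma commutator_split (c : R) : exists a b : R,
  [/\ c = - 4 * (a * b), `|a| = Num.sqrt `|c| / 2 & `|b| = Num.sqrt `|c| / 2].
Proof.
have s0 := sqrtr_ge0 `|c|; have sE := sqr_sqrtr (normr_ge0 c).
have hE : `|Num.sqrt `|c| / 2| = Num.sqrt `|c| / 2.
  by rewrite ger0_norm //; lra.
have [c0|c0] := leP 0 c.
  exists (- (Num.sqrt `|c| / 2)), (Num.sqrt `|c| / 2); rewrite normrN hE; split=> //.
  by move: sE; rewrite (ger0_norm c0) => {1}<-; field.
exists (Num.sqrt `|c| / 2), (Num.sqrt `|c| / 2); rewrite hE; split=> //.
by move/(congr1 -%R): sE; rewrite (ltr0_norm c0) opprK => {1}<-; field.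
Qed.

Lemma ler_norm_sum6 (t1 t2 t3 t4 t5 t6 m : R) : `|t1| <= m -> `|t2| <= m ->
  `|t3| <= m -> `|t4| <= m -> `|t5| <= m -> `|t6| <= m ->
  `|t1 + t2 + t3 + t4 + t5 + t6| <= 6 * m.
Proof.
rewrite !ler_norml => /andP[? ?] /andP[? ?] /andP[? ?] /andP[? ?] /andP[? ?] /andP[? ?].
by apply/andP; split; lra.
Qed.

(* V is a product of six horizontal moves of size at most its gauge: one along
   X, one along Y, and a commutator square producing the vertical part. *)
Lemma pansu_uniform rho f (K : set (heis R)) : homogeneous_norm rho ->
  C1H rho f -> compact K ->
  forall e : R, 0 < e -> exists2 r : R, 0 < r & forall P V, K P -> hgauge V < r ->
    `|f (hmul P V) - f P - (V.1.1 * Xder f P + V.1.2 * Yder f P)| <= e * hgauge V.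
Proof.
move=> hr fC cK e e0; have [cX cY dX dY] := C1H_horizontal hr fC.
have e6 : 0 < e / 6 by lra.
have [r1 r10 uX] := compact_uniform_continuous cK (fun x _ => cX x) e6.
have [r2 r20 uY] := compact_uniform_continuous cK (fun x _ => cY x) e6.
have [M M0 KM] := compact_continuous_bounded cK (fun x _ => @norm_continuous _ _ x).
(* Gauge at most 1 makes the gauge dominate the Euclidean norm; 1 + 4M bounds the constant of
   [hmul_dist] on [K]. *)
pose r := Num.min 1 (Num.min r1 r2 / (1 + 4 * M)).
have m0 : 0 < Num.min r1 r2 by rewrite lt_min r10.
have r0 : 0 < r by rewrite lt_min ltr01 divr_gt0 //; lra.
have near P W : K P -> hgauge W < r -> `|P - hmul P W| < Num.min r1 r2.
  move=> KP; rewrite lt_min => /andP[W1 Wr].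
  have := hmul_dist P W; have := hgauge_norm (ltW W1).
  move: Wr; rewrite ltr_pdivlMr; last lra.
  have := KM P KP; rewrite normr_id; have := normr_ge0 W; have := normr_ge0 P; nra.
(* One move along X from [hmul P U]: the derivative at the mean value point is compared with its
   value at [P] itself, so that all six moves share the same coefficients. *)
have stepX P U s m : K P -> `|s| <= m -> hgauge U + 2 * m < r ->
    `|f (hmul P (hmul U (s, 0, 0))) - f (hmul P U) - s * Xder f P| <= e / 6 * m.
  move=> KP sm Ur; have [c cs] := MVT_origin s (dX (hmul P U)).
  rewrite hmul0 -!hmulA => ->; rewrite (mulrC s) -mulrBl normrM ler_pM //.
  rewrite distrC ltW // uX //.
  apply: lt_le_trans (near _ _ KP _) _; last by rewrite ge_min lexx.
  by apply: le_lt_trans (hgauge_hmul _ _) _; rewrite (hgauge_horizontal _).1; lra.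
have stepY P U s m : K P -> `|s| <= m -> hgauge U + 2 * m < r ->
    `|f (hmul P (hmul U (0, s, 0))) - f (hmul P U) - s * Yder f P| <= e / 6 * m.
  move=> KP sm Ur; have [c cs] := MVT_origin s (dY (hmul P U)).
  rewrite hmul0 -!hmulA => ->; rewrite (mulrC s) -mulrBl normrM ler_pM //.
  rewrite distrC ltW // uY //.
  apply: lt_le_trans (near _ _ KP _) _; last by rewrite ge_min lexx orbT.
  by apply: le_lt_trans (hgauge_hmul _ _) _; rewrite (hgauge_horizontal _).2; lra.
(* Each move adds at most 2n to the gauge: at most 10n before the sixth move and 12n after it,
   whence the radius [r / 12]. *)
have small (n g m : R) : n < r / 12 -> g <= m -> m <= 10 * n -> g + 2 * n < r by lra.
have le10 (n : R) : 0 <= n -> [/\ 0 <= 10 * n, 2 * n <= 10 * n &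
    2 * n + 2 * n <= 10 * n] /\ [/\ 2 * n + 2 * n + 2 * n <= 10 * n,
    2 * n + 2 * n + 2 * n + 2 * n <= 10 * n &
    2 * n + 2 * n + 2 * n + 2 * n + 2 * n <= 10 * n].
  by move=> n0; split; split; lra.
exists (r / 12); first lra.
move=> P [[x y] z] KP; set V := (x, y, z); set n := hgauge V => nr.
have [/= xn yn zn] := hgauge_coords V; have n0 := hgauge_ge0 V.
rewrite -/n in xn yn zn n0.
(* The moves by [x] and [y] end at height -2xy, so the commutator must supply z + 2xy. This is at
   most 3n^2 in absolute value, below (2n)^2, which keeps [a] and [b] within n. *)
have [a [b [abE aE bE]]] := commutator_split (z + 2 * (x * y)).
have cn : Num.sqrt `|z + 2 * (x * y)| / 2 <= n.
  rewrite ler_pdivrMr //; have -> : n * 2 = Num.sqrt ((n * 2) ^+ 2).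
    by rewrite sqrtr_sqr ger0_norm //; lra.
  rewrite ler_sqrt ?sqr_ge0 //.
  have : `|2 * (x * y)| <= 2 * (n * n).
    by rewrite normrM (@ger0_norm _ 2) // ler_pM2l // normrM ler_pM.
  have := ler_normD z (2 * (x * y)); nra.
have an : `|a| <= n by rewrite aE.
have bn : `|b| <= n by rewrite bE.
pose U1 : heis R := hmul 0 (x, 0, 0).
pose U2 := hmul U1 (0, y, 0).
pose U3 := hmul U2 (a, 0, 0).
pose U4 := hmul U3 (0, b, 0).
pose U5 := hmul U4 (- a, 0, 0).
have VE : V = hmul U5 (0, - b, 0).
  rewrite /V /U5 /U4 /U3 /U2 /U1 /hmul /=; congr (_, _, _); first ring; first ring.
  by have -> : z = - 4 * (a * b) - 2 * (x * y); [rewrite -abE; ring|ring].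
have g0 : hgauge (0 : heis R) = 0 by rewrite -[RHS](normr0 R) -(hgauge_horizontal 0).1.
have gX U s : `|s| <= n -> hgauge (hmul U (s, 0, 0)) <= hgauge U + 2 * n.
  by move=> sn; have := hgauge_hmul U (s, 0, 0); rewrite (hgauge_horizontal s).1; lra.
have gY U s : `|s| <= n -> hgauge (hmul U (0, s, 0)) <= hgauge U + 2 * n.
  by move=> sn; have := hgauge_hmul U (0, s, 0); rewrite (hgauge_horizontal s).2; lra.
have g1 : hgauge U1 <= 2 * n by apply: le_trans (gX _ _ xn) _; rewrite g0 add0r.
have {}gX U s m : hgauge U <= m -> `|s| <= n -> hgauge (hmul U (s, 0, 0)) <= m + 2 * n.
  by move=> Um /gX /le_trans; apply; rewrite lerD2r.
have {}gY U s m : hgauge U <= m -> `|s| <= n -> hgauge (hmul U (0, s, 0)) <= m + 2 * n.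
  by move=> Um /gY /le_trans; apply; rewrite lerD2r.
have g2 := gY _ _ _ g1 yn; have g3 := gX _ _ _ g2 an; have g4 := gY _ _ _ g3 bn.
have Na : `|- a| <= n by rewrite normrN.
have Nb : `|- b| <= n by rewrite normrN.
have g5 := gX _ _ _ g4 Na.
have {}small U m : hgauge U <= m -> m <= 10 * n -> hgauge U + 2 * n < r.
  exact: small.
have [[k0 k1 k2] [k3 k4 k5]] := le10 n n0.
have {}g0 : hgauge (0 : heis R) <= 0 by rewrite g0.
have h1 := stepX P 0 x n KP xn (small _ 0 g0 k0).
have h2 := stepY P U1 y n KP yn (small _ _ g1 k1).
have h3 := stepX P U2 a n KP an (small _ _ g2 k2).
have h4 := stepY P U3 b n KP bn (small _ _ g3 k3).
have h5 := stepX P U4 (- a) n KP Na (small _ _ g4 k4).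
have h6 := stepY P U5 (- b) n KP Nb (small _ _ g5 k5).
have := ler_norm_sum6 h1 h2 h3 h4 h5 h6.
rewrite -/U1 -/U2 -/U3 -/U4 -/U5 -VE hmul0.
have -> : e * n = 6 * (e / 6 * n) by field.
(* The six increments telescope, and the first order terms of [a], [- a] and of [b], [- b]
   cancel. *)
move=> h; congr (_ <= _): h; congr `|_| => /=; ring.
Qed.


End UniformDifferentiability.

(** * First order expansion of [phi] in the gauge of [graph_diff] *)

Section IntrinsicDifferentiability.
Context {R : realType}.
Implicit Types (A B : plane R) (rho f : heis R -> R) (phi : plane R -> R).

Definition graph_diff phi A B : heis R :=
  hmul (hinv (graph_map phi A)) (graph_map phi B).

Lemma graph_diffE phi A B : graph_diff phi A B =
  (phi B - phi A, B.1 - A.1, B.2 - A.2 + 2 * ((phi A + phi B) * (B.1 - A.1))).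
Proof. by rewrite /graph_diff /graph_map /hmul /hinv /=; congr (_, _, _); ring. Qed.

Lemma hmul_graph_diff phi A B :
  hmul (graph_map phi A) (graph_diff phi A B) = graph_map phi B.
Proof. by rewrite graph_diffE /graph_map /hmul /=; congr (_, _, _); ring. Qed.

Lemma plane_norm_ge A : `|A.1| <= `|A| /\ `|A.2| <= `|A|.
Proof. by split; rewrite le_max lexx ?orbT. Qed.

Lemma graph_map_continuous phi A : {for A, continuous phi} ->
  {for A, continuous (graph_map phi)}.
Proof.
move=> cp.
have c1 : {for A, continuous (fun p : plane R => p.1)} by exact: cvg_fst.
have c2 : {for A, continuous (fun p : plane R => p.2)} by exact: cvg_snd.
have -> : graph_map phi = fun p => (phi p, p.1, p.2 + 2 * (phi p * p.1)).
  by apply/funext => p; rewrite /graph_map /hmul /=; congr (_, _, _); ring.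
apply: pair_continuous_at; first exact: pair_continuous_at.
apply: (continuousD c2); apply: (@continuousM _ _ (cst 2) (fun p => phi p * p.1)).
  exact: cst_continuous.
exact: (continuousM cp c1).
Qed.

Lemma graph_diff_small phi (K : set (plane R)) : compact K ->
  (forall A, K A -> {for A, continuous phi}) ->
  forall e : R, 0 < e -> exists2 r : R, 0 < r &
    forall A B, K A -> `|A - B| < r -> hgauge (graph_diff phi A B) < e.
Proof.
move=> cK cp e e0.
have [M M0 pM] := compact_continuous_bounded cK cp.
pose s := Num.min (e / 2) 1.
have [s0 se s1] : [/\ 0 < s, s <= e / 2 & s <= 1].
  by rewrite /s lt_min !ge_min !lexx orbT; split=> //; apply/andP; split; lra.
have [r r0 pr] := compact_uniform_continuous cK cp s0.
(* Since [s <= 1], the sum [phi A + phi B] is at most 2M + 1 in absolute value, so the vertical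
   coordinate is at most (4M + 3)n, with n the Euclidean distance; it has to be below s^2. *)
exists (Num.min r (s ^+ 2 / (4 * M + 3))).
  by rewrite lt_min r0 divr_gt0 ?exprn_gt0 //; lra.
move=> A B KA; rewrite lt_min => /andP[rAB].
rewrite ltr_pdivlMr; last lra.
have := pr A B KA rAB; have := pM A KA; have [h1 h2] := plane_norm_ge (A - B).
rewrite /= in h1 h2; have n0 := normr_ge0 (A - B).
move: (`|A - B|) h1 h2 n0 => n h1 h2 n0 hA hAB hn.
apply: (@le_lt_trans _ _ s); last lra.
clear pM pr.
have ns : n <= s by nra.
rewrite graph_diffE; apply: hgauge_le => /=; first lra.
- by rewrite distrC ltW.
- by rewrite distrC; lra.
have hB : `|phi A + phi B| <= 2 * M + 1.
  have -> : phi A + phi B = 2 * phi A - (phi A - phi B) by ring.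
  have := ler_normB (2 * phi A) (phi A - phi B).
  rewrite normrM (@ger0_norm _ 2) //; lra.
have h3 : `|(phi A + phi B) * (B.1 - A.1)| <= (2 * M + 1) * n.
  by rewrite normrM ler_pM // distrC.
have := ler_normD (B.2 - A.2) (2 * ((phi A + phi B) * (B.1 - A.1))).
rewrite normrM (@ger0_norm _ 2) // (distrC B.2); nra.
Qed.

(** As [f] vanishes at both graph points, its Pansu expansion leaves only the linear part, which is
    therefore small against the gauge; dividing by [Xder f], whose inverse is bounded on [K],
    isolates the increment of [phi]. *)
Lemma intrinsic_differentiability rho f phi (K : set (plane R)) :
  homogeneous_norm rho -> C1H rho f -> compact K ->
  (forall A, K A -> {for A, continuous phi}) ->
  (forall A, K A -> Xder f (graph_map phi A) != 0) ->
  forall e : R, 0 < e -> exists2 r : R, 0 < r & forall A B, K A ->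
    f (graph_map phi A) = 0 -> f (graph_map phi B) = 0 -> `|A - B| < r ->
    `|phi B - phi A - graph_slope f phi A * (B.1 - A.1)| <=
      e * hgauge (graph_diff phi A B).
Proof.
move=> hr fC cK cp X0 e e0; have [cX _ _ _] := C1H_horizontal hr fC.
have cXV A : K A -> {for A, continuous (fun p => (Xder f (graph_map phi p))^-1)}.
  move=> KA; apply: continuousV; first exact: X0.
  by apply: continuous_comp; [apply: graph_map_continuous; exact: cp|exact: cX].
have [M M0 XM] := compact_continuous_bounded cK cXV.
have cPK : compact (graph_map phi @` K).
  apply: continuous_compact => //; apply: continuous_in_subspaceT => A /set_mem KA.
  exact: graph_map_continuous (cp A KA).
have eM : 0 < e / M by rewrite divr_gt0.
have [r r0 fr] := pansu_uniform hr fC cPK eM.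
have [d d0 gd] := graph_diff_small cK cp r0.
exists d => // A B KA fA fB AB.
have := fr _ (graph_diff phi A B) (ex_intro2 _ _ A KA erefl) (gd A B KA AB).
rewrite hmul_graph_diff fA fB subrr sub0r normrN => H.
have x0 := X0 A KA; have xM := XM A KA.
have -> : phi B - phi A - graph_slope f phi A * (B.1 - A.1) =
  (Xder f (graph_map phi A))^-1 * ((graph_diff phi A B).1.1 * Xder f (graph_map phi A) +
    (graph_diff phi A B).1.2 * Yder f (graph_map phi A)).
  by rewrite graph_diffE /graph_slope /=; field.
rewrite normrM.
have -> : e * hgauge (graph_diff phi A B) = M * (e / M * hgauge (graph_diff phi A B)).
  by field; apply: lt0r_neq0.
by rewrite ler_pM.
Qed.

Lemma graph_slope_bounded rho f phi (K : set (plane R)) :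
  homogeneous_norm rho -> C1H rho f -> compact K ->
  (forall A, K A -> {for A, continuous phi}) ->
  (forall A, K A -> Xder f (graph_map phi A) != 0) ->
  exists2 M : R, 0 < M & forall A, K A -> `|graph_slope f phi A| <= M.
Proof.
move=> hr fC cK cp X0; have [cX cY _ _] := C1H_horizontal hr fC.
apply: compact_continuous_bounded => // A KA.
have cP := graph_map_continuous (cp A KA).
apply: continuousN; apply: continuousM; first exact: continuous_comp cP (cY _).
by apply: continuousV; [exact: X0|exact: continuous_comp cP (cX _)].
Qed.

End IntrinsicDifferentiability.

(** * Confinement of integral curves for short times *)

Section HalfCurves.
Context {R : realType}.
Implicit Types (A B : plane R) (phi w : plane R -> R) (K : set (plane R)).
Implicit Types (sg H s : R) (zeta : R -> R).

(* The half of an integral curve of W^phi through A on the side of the sign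
   sg, parametrized by s = sg * t >= 0. *)
Definition half_curve phi A sg H zeta : Prop :=
  zeta 0 = A.2 /\ forall s, 0 <= s <= H ->
    is_derive s 1 zeta (- 4 * (sg * phi (A.1 + sg * s, zeta s))).

Lemma half_curve_le phi A sg H H' zeta : H' <= H ->
  half_curve phi A sg H zeta -> half_curve phi A sg H' zeta.
Proof.
move=> HH [z0 dz]; split=> // s /andP[s0 sH]; apply: dz.
by rewrite s0 (le_trans sH).
Qed.

Lemma half_curve_continuous phi A sg H zeta s : half_curve phi A sg H zeta ->
  0 <= s <= H -> {for s, continuous zeta}.
Proof.
move=> [_ dz] /dz [d _].
by apply: differentiable_continuous; apply/derivable1_diffP.
Qed.

(** A first exit argument: while the curve stays near [A], [phi] is bounded by M + 1 along it, so
    its speed is at most 4(M + 1) and it cannot leave the neighbourhood before time [d]. The time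
    depends only on [K] and [r]. *)
Lemma half_curve_stays phi K : compact K ->
  (forall A, K A -> {for A, continuous phi}) ->
  forall r : R, 0 < r -> exists2 d : R, 0 < d &
    forall A sg H zeta, K A -> `|sg| = 1 -> H < d -> half_curve phi A sg H zeta ->
    forall s, 0 <= s <= H -> `|A - (A.1 + sg * s, zeta s)| < r.
Proof.
move=> cK cp r r0.
have [M M0 pM] := compact_continuous_bounded cK cp.
have [r1 r10 pr] := compact_uniform_continuous cK cp ltr01.
pose e := Num.min r r1.
have e0 : 0 < e by rewrite lt_min r0.
(* M + 2 instead of M + 1 makes the final inequality strict. *)
pose d := e / (4 * (M + 2)).
have d0 : 0 < d by rewrite divr_gt0 //; lra.
exists d => // A sg H zeta KA sg1 Hd hz.
have de : d * (4 * (M + 2)) = e by rewrite /d; field; lra.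
have near t z : 0 <= t < d -> `|z - A.2| < e -> `|A - (A.1 + sg * t, z)| < e.
  move=> /andP[t0 td] zA; rewrite gt_max /= distrC addrC addKr normrM sg1 mul1r.
  rewrite ger0_norm // distrC zA andbT; nra.
suff stay s : 0 <= s <= H -> `|zeta s - A.2| < e.
  move=> s /[dup] /stay zs /andP[s0 sH].
  apply: (@lt_le_trans _ _ e); last by rewrite ge_min lexx.
  by apply: near => //; rewrite s0 (le_lt_trans sH).
move=> /andP[s0 sH]; rewrite ltNge; apply/negP => es.
(* The exit times; by continuity the infimum [c] is itself one of them, and it is positive. *)
pose E := [set t | 0 <= t <= s /\ e <= `|zeta t - A.2|].
have hE : has_inf E.
  by split; [exists s; split => //; rewrite s0 lexx|exists 0 => t [/andP[]]].
pose c := inf E.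
have c0 : 0 <= c by apply: lb_le_inf; [exact: hE.1|move=> t [/andP[]]].
have cs : c <= s by apply: ge_inf; [exact: hE.2|split => //; rewrite s0 lexx].
have cont t : 0 <= t <= c -> {for t, continuous zeta}.
  move=> /andP[t0 tc]; apply: half_curve_continuous hz _.
  by rewrite t0 (le_trans tc) // (le_trans cs).
have ec : e <= `|zeta c - A.2|.
  rewrite leNgt; apply/negP => zc.
  have /cvgrPdist_lt/(_ (e - `|zeta c - A.2|)) :=
    cont c (introT andP (conj c0 (lexx c))).
  rewrite subr_gt0 => /(_ zc) /nbhs_ballP[b /= b0 zb].
  have [t Et tc] := inf_adherent b0 hE.
  have ct : c <= t by apply: ge_inf => //; exact: hE.2.
  have := zb t; rewrite -ball_normE /= distrC ger0_norm ?subr_ge0 // -/c in tc *.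
  rewrite ltrBlDl => /(_ tc) zt; case: Et => _ et.
  have := ler_normD (zeta t - zeta c) (zeta c - A.2).
  rewrite addrA subrK (distrC (zeta t) (zeta c)); lra.
have cp0 : 0 < c.
  rewrite lt_neqAle c0 andbT; apply/eqP => c0E; move: ec.
  by rewrite -c0E (hz.1) subrr normr0; lra.
(* The mean value point lies strictly before the first exit, so the speed bound is available
   there. *)
have [||t] := @MVT R zeta (fun t => - 4 * (sg * phi (A.1 + sg * t, zeta t))) 0 c cp0.
- move=> t; rewrite in_itv /= => /andP[t0 tc]; apply: hz.2.
  by rewrite ltW //= (le_trans (ltW tc)) // (le_trans cs).
- by apply: continuous_in_subspaceT => t /set_mem /=; rewrite in_itv /=; exact: cont.
rewrite in_itv /= hz.1 subr0 => /andP[t0 tc] E1; move: ec; rewrite E1.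
rewrite !normrM sg1 mul1r normrN (@ger0_norm _ 4) // (ger0_norm c0).
have zt : `|zeta t - A.2| < e.
  rewrite ltNge; apply/negP => et; have : c <= t.
    by apply: ge_inf; [exact: hE.2|split => //; rewrite ltW //= (le_trans (ltW tc))].
  by rewrite leNgt tc.
have td : t < d.
  by apply: lt_le_trans tc _; apply: le_trans (ltW Hd); apply: le_trans sH.
have nt : `|A - (A.1 + sg * t, zeta t)| < r1.
  apply: lt_le_trans (near t (zeta t) _ zt) _; first by rewrite ltW.
  by rewrite ge_min lexx orbT.
have := pr A _ KA nt; have := pM A KA.
set p := phi _; set q := phi _ => hp hq.
have qM : `|q| <= M + 1.
  by have := ler_normB p (p - q); rewrite opprB addrC subrK; lra.
have cd : c < d by apply: le_lt_trans cs _; apply: le_lt_trans sH Hd.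
clear -qM cd d0 cp0 de M0 e0; nra.
Qed.

End HalfCurves.

(** * Second order expansion along integral curves *)

Section CurveExpansion.
Context {R : realType}.
Context (phi w : plane R -> R) (K Om : set (plane R)) (M : R).
Context (cK : compact K) (KOm : K `<=` Om).
Context (cphi : forall A, Om A -> {for A, continuous phi}).
Context (phi_diff : forall e : R, 0 < e -> exists2 r : R, 0 < r &
  forall A B, K A -> Om B -> `|A - B| < r ->
    `|phi B - phi A - w A * (B.1 - A.1)| <= e * hgauge (graph_diff phi A B)).
Context (wM : forall A, K A -> `|w A| <= M).

Let curve_in A sg H zeta := half_curve phi A sg H zeta /\
  forall s, 0 <= s <= H -> Om (A.1 + sg * s, zeta s).

Lemma graph_diff_curve A sg s z : graph_diff phi A (A.1 + sg * s, z) =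
  (phi (A.1 + sg * s, z) - phi A, sg * s,
   z - A.2 + 4 * phi A * (sg * s) +
   2 * ((phi (A.1 + sg * s, z) - phi A) * (sg * s))).
Proof. by rewrite graph_diffE /=; congr (_, _, _); ring. Qed.

(** If [phi] grows like b t along the curve, then [zeta] follows the parabola with terms -4 phi(A) t
    and -2b t^2. Subtracting it leaves a function whose derivative is -4 times the signed error of
    [phi]. Used with [b = 0] for the crude bound and with [b = w A] for the sharp one. *)
Lemma half_curve_deviation A sg H zeta (b m : R) : `|sg| = 1 -> 0 <= H ->
  half_curve phi A sg H zeta ->
  (forall s, 0 <= s <= H ->
    `|phi (A.1 + sg * s, zeta s) - phi A - b * (sg * s)| <= m) ->
  `|zeta H - A.2 + 4 * phi A * (sg * H) + 2 * b * H ^+ 2| <= 4 * m * H.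
Proof.
move=> sg1 H0 hz hm.
have sg2 : sg * sg = 1 by rewrite -expr2 -real_normK ?num_real // sg1 expr1n.
pose psi := fun s => zeta s + 4 * phi A * (sg * s) + 2 * b * s ^+ 2.
pose dpsi := fun s => - 4 * (sg * (phi (A.1 + sg * s, zeta s) - phi A - b * (sg * s))).
have dP s : 0 <= s <= H -> is_derive s 1 psi (dpsi s).
  move=> /(hz.2) dz; rewrite /psi.
  have d1 : is_derive s 1 (fun s : R => 4 * phi A * (sg * s)) (4 * phi A * sg).
    by apply: is_derive_eq; rewrite /GRing.scale /=; ring.
  have d2 : is_derive s 1 (fun s : R => 2 * b * s ^+ 2) (4 * b * s).
    by apply: is_derive_eq; rewrite /GRing.scale /=; ring.
  apply: is_derive_eq; rewrite /dpsi.
  have -> : 4 * b * s = 4 * b * ((sg * sg) * s) by rewrite sg2 mul1r.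
  ring.
have [c cH] := MVT_closed H0 dP.
have -> : psi H - psi 0 = zeta H - A.2 + 4 * phi A * (sg * H) + 2 * b * H ^+ 2.
  by rewrite /psi hz.1; ring.
move=> ->; rewrite subr0 /dpsi !normrM sg1 mul1r normrN (@ger0_norm _ 4) //.
by rewrite (ger0_norm H0) ler_wpM2r // ler_pM2l // hm.
Qed.

Let cphiK A (KA : K A) : {for A, continuous phi} := cphi (KOm KA).

Lemma curve_in_continuous A sg H zeta s : curve_in A sg H zeta -> 0 <= s <= H ->
  {for s, continuous (fun t => phi (A.1 + sg * t, zeta t))}.
Proof.
move=> [hz hO] sH.
apply: (@continuous_comp _ _ _ (fun t => (A.1 + sg * t, zeta t)) phi);
  last exact: cphi (hO s sH).
apply: pair_continuous_at; last exact: half_curve_continuous hz sH.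
apply: (@continuousD _ _ _ (cst A.1)); first exact: cst_continuous.
exact: mulrl_continuous.
Qed.

(** An absorption argument: the largest increment m of [phi] along the curve bounds the gauge by 3(m
    + H), and the expansion of [phi] at the maximum point bounds m in turn by |M| H plus a small
    multiple of that gauge. *)
Lemma half_curve_lipschitz : exists2 C : R, 0 < C & exists2 d : R, 0 < d &
  forall A sg H zeta, K A -> `|sg| = 1 -> 0 <= H < d -> curve_in A sg H zeta ->
    hgauge (graph_diff phi A (A.1 + sg * H, zeta H)) <= C * H.
Proof.
(* Against the factor 3 of the gauge bound, 1/12 leaves m/4 on the right, which is absorbed on the
   left. *)
have [|r r0 pr] := phi_diff (e := 12^-1); first lra.
have [d d0 hd] := half_curve_stays cK cphiK r0.
exists (3 * (2 * `|M| + 2)); first by have := normr_ge0 M; lra.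
exists d => // A sg H zeta KA sg1 /andP[H0 Hd] hc; have [hz hO] := hc.
pose g s := phi (A.1 + sg * s, zeta s) - phi A.
have cg : {within `[0, H], continuous (fun s => `|g s|)}.
  apply: continuous_in_subspaceT => s /set_mem; rewrite /= in_itv /= => sH.
  apply: (@continuous_comp _ _ _ g Num.norm); last exact: norm_continuous.
  by apply: continuousB; [exact: curve_in_continuous hc sH|exact: cst_continuous].
have [c] := EVT_max H0 cg; rewrite in_itv /= => cH gm.
set m := `|g c| in gm; have m0 : 0 <= m by exact: normr_ge0.
have {}gm s : 0 <= s <= H -> `|g s| <= m by move=> sH; apply: gm; rewrite in_itv.
have sgn (x : R) : 0 <= x -> `|sg * x| = x.
  by move=> x0; rewrite normrM sg1 mul1r ger0_norm.
have gauge s : 0 <= s <= H ->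
    hgauge (graph_diff phi A (A.1 + sg * s, zeta s)) <= 3 * (m + H).
  move=> /[dup] sH /andP[s0 sH'].
  have := half_curve_deviation (b := 0) (m := m) sg1 s0 (half_curve_le sH' hz).
  rewrite mulr0 mul0r addr0 => /(_ _) h; rewrite graph_diff_curve -/(g s).
  have {}h : `|zeta s - A.2 + 4 * phi A * (sg * s)| <= 4 * m * s.
    apply: h => t /andP[t0 ts]; rewrite mul0r subr0.
    by apply: gm; rewrite t0 (le_trans ts).
  have gs := gm s sH.
  have h2 : `|g s * (sg * s)| <= m * s by rewrite normrM sgn // ler_wpM2r.
  clear -h h2 gs m0 H0 s0 sH' sgn; apply: hgauge_le => /=; first lra.
  - lra.
  - by rewrite sgn //; lra.
  apply: le_trans (ler_normD _ _) _; rewrite [`|2 * _|]normrM (@ger0_norm _ 2) //; nra.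
have cin := hO c cH; have := pr A _ KA cin (hd A sg H zeta KA sg1 Hd hz c cH).
have gc := gauge c cH; have wA := wM KA.
have [c0 cH'] := andP cH; rewrite -/(g c) /=.
have -> : A.1 + sg * c - A.1 = sg * c by ring.
move=> h.
have hw : `|w A * (sg * c)| <= `|M| * H.
  by rewrite normrM sgn // ler_pM // (le_trans wA) // ler_norm.
have := ler_normD (g c - w A * (sg * c)) (w A * (sg * c)); rewrite subrK -/m => hm.
have mH : m <= (2 * `|M| + 1) * H.
  have MH : 0 <= `|M| * H by rewrite mulr_ge0.
  clear -h gc hw hm m0 H0 MH. lra.
apply: le_trans (gauge H _) _; first by rewrite H0 lexx.
by lra.
Qed.

Lemma half_curve_expansion (e : R) : 0 < e -> exists2 d : R, 0 < d &
  forall A sg H zeta, K A -> `|sg| = 1 -> 0 <= H < d -> curve_in A sg H zeta ->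
    `|phi (A.1 + sg * H, zeta H) - phi A - w A * (sg * H)| <= e * H /\
    `|(graph_diff phi A (A.1 + sg * H, zeta H)).2| <= e * H ^+ 2.
Proof.
move=> e0; have [C C0 [d1 d10 lip]] := half_curve_lipschitz.
(* The gauge along the curve is at most C s, so the error of [phi] is (e/6) s; the vertical part
   collects it with weights 4 and 2. *)
have e1 : 0 < e / (6 * C) by rewrite divr_gt0 //; lra.
have [r r0 pr] := phi_diff e1.
have [d2 d20 hd] := half_curve_stays cK cphiK r0.
exists (Num.min d1 d2) => [|A sg H zeta KA sg1 /andP[H0]]; first by rewrite lt_min d10.
rewrite lt_min => /andP[Hd1 Hd2] [hz hO].
have sg2 : sg * sg = 1 by rewrite -expr2 -real_normK ?num_real // sg1 expr1n.
have exp s : 0 <= s <= H ->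
    `|phi (A.1 + sg * s, zeta s) - phi A - w A * (sg * s)| <= e / 6 * s.
  move=> /[dup] sH /andP[s0 sH'].
  have cs : curve_in A sg s zeta.
    split; first exact: half_curve_le hz.
    by move=> t /andP[t0 ts]; apply: hO; rewrite t0 (le_trans ts).
  have := pr A _ KA (hO s sH) (hd A sg H zeta KA sg1 Hd2 hz s sH).
  rewrite /=; have -> : A.1 + sg * s - A.1 = sg * s by ring.
  move=> h; apply: le_trans h _.
  have -> : e / 6 * s = e / (6 * C) * (C * s) by field; exact: lt0r_neq0.
  rewrite ler_pM2l //; apply: lip => //.
  by rewrite s0 (le_lt_trans sH').
have HH : 0 <= H <= H by rewrite H0 lexx.
have eH := exp H HH.
have e6 : e / 6 <= e by lra.
split; first by apply: le_trans eH _; rewrite ler_wpM2r.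
have := half_curve_deviation (b := w A) (m := e / 6 * H) sg1 H0 hz.
rewrite graph_diff_curve /=; set g := phi _ - _ => h.
have {}h : `|zeta H - A.2 + 4 * phi A * (sg * H) + 2 * w A * H ^+ 2| <=
    4 * (e / 6 * H) * H.
  apply: h => s /[dup] sH /andP[s0 sH']; apply: le_trans (exp s sH) _.
  by rewrite ler_pM2l //; lra.
(* The cancellation: the curve contributes -2 w(A) H^2 and the group law +2 w(A) H^2, leaving two
   error terms. *)
have -> : zeta H - A.2 + 4 * phi A * (sg * H) + 2 * (g * (sg * H)) =
    zeta H - A.2 + 4 * phi A * (sg * H) + 2 * w A * H ^+ 2 +
    2 * (g - w A * (sg * H)) * (sg * H).
  have -> : 2 * w A * H ^+ 2 = 2 * w A * ((sg * sg) * H ^+ 2) by rewrite sg2 mul1r.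
  by ring.
have h2 : `|2 * (g - w A * (sg * H)) * (sg * H)| <= 2 * (e / 6 * H) * H.
  rewrite !normrM sg1 mul1r (ger0_norm H0) (@ger0_norm _ 2) //.
  by rewrite ler_wpM2r // ler_pM2l.
apply: le_trans (ler_normD _ _) _; apply: le_trans (lerD h h2) _; lra.
Qed.

End CurveExpansion.

(** * Comparison of homogeneous norms with the gauge *)

Section HomogeneousNorms.
Context {R : realType}.
Implicit Types (U V : heis R) (rho : heis R -> R).

Let box : set (heis R) := `[-1, 1] `*` `[-1, 1] `*` `[-1, 1].

Let box_compact : compact box.
Proof.
do 2 (apply: compact_setX; last exact: segment_compact).
exact: segment_compact.
Qed.

Let box_norm V : `|V| <= 1 -> box V.
Proof.
rewrite !ge_max /box /= !in_itv /= => /andP[/andP[]].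
by rewrite !ler_norml => -> -> ->.
Qed.

Lemma hgauge_eq1 V : hgauge V = 1 -> `|V| = 1.
Proof.
move=> V1; apply/eqP; rewrite eq_le -{1}V1 hgauge_norm ?V1 // leNgt; apply/negP.
rewrite !gt_max => /andP[/andP[h1 h2] h3]; have : hgauge V < 1.
  by rewrite /hgauge !gt_max h1 h2 /= -sqrtr1 ltr_sqrt.
by rewrite V1 ltxx.
Qed.

(** The inverse of [rho] is bounded on the compact sup-norm unit sphere, which contains the gauge
    unit sphere; dilations carry the bound to every [V]. *)
Lemma hgauge_le_hnorm rho : homogeneous_norm rho ->
  exists2 c : R, 0 < c & forall V, hgauge V <= c * rho V.
Proof.
move=> hr; pose S := [set V : heis R | `|V| = 1].
have cS : compact S.
  apply: (@subclosed_compact _ S box) => //; last first.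
    by move=> V /= V1; apply: box_norm; rewrite V1.
  apply: (@closed_comp _ _ (fun V : heis R => `|V|) [set 1]) => [V _|].
    exact: norm_continuous.
  exact: closed_eq.
have [V V1|M M0 SM] := compact_continuous_bounded (u := fun V => (rho V)^-1) cS.
  apply: continuousV; last exact: hnorm_continuous.
  apply/eqP => /(hnorm_eq0 hr) V0; move: V1; rewrite /S /= V0 normr0 => /esym/eqP.
  by rewrite oner_eq0.
exists M => // V; have [/eqP|n0] := eqVneq (hgauge V) 0.
  by move/eqP => ->; rewrite mulr_ge0 ?(ltW M0) // hnorm_ge0.
have {}n0 : 0 < hgauge V by rewrite lt_neqAle eq_sym n0 hgauge_ge0.
set n := hgauge V in n0 *; have ni : 0 < n^-1 by rewrite invr_gt0.
have S1 : S (dil n^-1 V).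
  by apply: hgauge_eq1; rewrite hgauge_dil // mulVf // lt0r_neq0.
have r0 := hnorm_ge0 hr V.
have := SM _ S1; rewrite hnorm_dil // ger0_norm ?invr_ge0 ?mulr_ge0 ?(ltW ni) //.
rewrite invfM invrK.
case: (eqVneq (rho V) 0) => [/(hnorm_eq0 hr) V0|rn].
  by move: n0; rewrite /n V0 /hgauge /= !normr0 sqrtr0 !maxxx ltxx.
by rewrite ler_pdivrMr // lt_neqAle eq_sym rn.
Qed.

(** Dilating by the inverse gauge of [U] turns the anisotropic hypotheses into Euclidean closeness
    to a point of the unit sphere, where [rho] is uniformly continuous. *)
Lemma hnorm_perturbation rho : homogeneous_norm rho ->
  forall e : R, 0 < e -> exists2 d : R, 0 < d & forall U V,
    `|U.1.1 - V.1.1| <= d * hgauge U -> `|U.1.2 - V.1.2| <= d * hgauge U ->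
    `|U.2 - V.2| <= d * hgauge U ^+ 2 -> `|rho U - rho V| <= e * hgauge U.
Proof.
move=> hr e e0.
have [r r0 hB] := compact_uniform_continuous box_compact
  (fun V _ => hnorm_continuous hr (x := V)) e0.
exists (r / 2) => [|U V]; first lra.
(* No dilation normalizes gauge 0, but then the hypotheses force [U = V]. *)
have [n0|n0] := eqVneq (hgauge U) 0.
  rewrite n0 expr0n !mulr0 !normr_le0 !subr_eq0 => /eqP E1 /eqP E2 /eqP E3.
  suff -> : U = V by [].
  rewrite (surjective_pairing U) (surjective_pairing U.1) E1 E2 E3.
  by rewrite -!surjective_pairing.
have {}n0 : 0 < hgauge U by rewrite lt_neqAle eq_sym n0 hgauge_ge0.
set n := hgauge U in n0 *; have ni : 0 < n^-1 by rewrite invr_gt0.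
move=> h1 h2 h3.
have U1 : box (dil n^-1 U).
  by apply: box_norm; rewrite hgauge_eq1 // hgauge_dil // mulVf // lt0r_neq0.
have UV : `|dil n^-1 U - dil n^-1 V| < r.
  apply: (@le_lt_trans _ _ (r / 2)); last lra.
  have nn : n != 0 by rewrite lt0r_neq0.
  apply: heis_norm_le => /=; rewrite -mulrBr normrM ger0_norm ?exprn_ge0 ?(ltW ni) //.
  - by rewrite ler_pdivrMl // mulrC.
  - by rewrite ler_pdivrMl // mulrC.
  - by rewrite exprVn ler_pdivrMl ?exprn_gt0 // mulrC.
have := hB _ _ U1 UV; rewrite !hnorm_dil // -mulrBr normrM gtr0_norm // => /ltW.
by rewrite ler_pdivrMl // mulrC.
Qed.

End HomogeneousNorms.

(** * From integral curves to half curves *)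

Section IntegralCurves.
Context {R : realType}.

Lemma is_derive_pair (g : R -> plane R) (t : R) (v : plane R) :
  is_derive t 1 g v -> is_derive t 1 (fun s => (g s).1) v.1 /\
  is_derive t 1 (fun s => (g s).2) v.2.
Proof.
move=> [dg gv].
have cv : (fun h : R => h^-1 *: ((g \o shift t) (h *: (1 : R)) - g t)) @ 0^' --> v.
  by rewrite -gv.
have cv1 : (fun h : R => h^-1 *:
    (((fun s => (g s).1) \o shift t) (h *: (1 : R)) - (g t).1))
    @ 0^' --> v.1.
  exact: (cvg_comp _ _ cv (@cvg_fst _ _ _ _ _)).
have cv2 : (fun h : R => h^-1 *:
    (((fun s => (g s).2) \o shift t) (h *: (1 : R)) - (g t).2))
    @ 0^' --> v.2.
  exact: (cvg_comp _ _ cv (@cvg_snd _ _ _ _ _)).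
split; split.
- exact: cvgP cv1.
- exact: cvg_lim cv1.
- exact: cvgP cv2.
- exact: cvg_lim cv2.
Qed.

Lemma integral_curve_half phi (Omega : set (plane R)) (I : set R)
    (g : R -> plane R) (A : plane R) (h : R) :
  integral_curve (Wvec phi) Omega I g -> g 0 = A ->
  `[Num.min 0 h, Num.max 0 h] `<=` I ->
  exists sg : R, [/\ `|sg| = 1, sg * `|h| = h,
    half_curve phi A sg `|h| (fun s => (g (sg * s)).2) &
    forall s, 0 <= s <= `|h| ->
      g (sg * s) = (A.1 + sg * s, (g (sg * s)).2) /\ Omega (g (sg * s))].
Proof.
move=> [_ _ gO dg] g0 hI.
(* The value at [h = 0] is 1, so that [sg] has modulus 1 in every case. *)
pose sg : R := if 0 <= h then 1 else -1.
have sg1 : `|sg| = 1 by rewrite /sg; case: ifP; rewrite ?normrN normr1.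
have sgh : sg * `|h| = h.
  rewrite /sg; case: (leP 0 h) => h0; first by rewrite mul1r ger0_norm.
  by rewrite mulN1r ltr0_norm // opprK.
have sI s : 0 <= s <= `|h| -> I (sg * s).
  move=> /andP[s0]; rewrite /sg => sh; apply: hI; rewrite /= in_itv /= ge_min le_max.
  case: (leP 0 h) sh => h0; first by rewrite mul1r ger0_norm // s0 => ->; rewrite orbT.
  by rewrite mulN1r ltr0_norm // oppr_le0 s0 => sh; rewrite (lerNr h) sh orbT.
have dsg (s : R) : is_derive s 1 (fun s : R => sg * s) sg.
  by apply: is_derive_eq; rewrite /GRing.scale /=; ring.
have d12 s : 0 <= s <= `|h| -> is_derive s 1 (fun s => (g (sg * s)).1) sg /\
    is_derive s 1 (fun s => (g (sg * s)).2) (- 4 * (sg * phi (g (sg * s)))).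
  move=> /sI /dg /is_derive_pair[d1 d2]; split.
    by have := is_derive1_comp d1 (dsg s); rewrite /= mul1r.
  by have := is_derive1_comp d2 (dsg s); rewrite /= -mulrA (mulrC _ sg).
(* The first component of [Wvec phi] is 1, so the first coordinate is affine in time. *)
have gE s : 0 <= s <= `|h| -> g (sg * s) = (A.1 + sg * s, (g (sg * s)).2).
  move=> /andP[s0 sh].
  have [|c _] := @MVT_closed _ (fun s => (g (sg * s)).1) (cst sg) 0 s s0.
    by move=> t /andP[t0 ts]; apply: (d12 t _).1; rewrite t0 (le_trans ts).
  rewrite mulr0 g0 subr0 /= => E; rewrite [LHS]surjective_pairing; congr (_, _).
  by apply/eqP; rewrite addrC -subr_eq E.
exists sg; split => // [|s sH].
  split; first by rewrite mulr0 g0.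
  by move=> s sH; rewrite -gE //; exact: (d12 s sH).2.
by split; [exact: gE|exact/gO/sI].
Qed.

End IntegralCurves.

(** * Comparison of the two distances *)

Theorem mainTheorem7 (R : realType) (rho : heis R -> R)
    (rho_norm : homogeneous_norm rho)
    (f : heis R -> R) (f_C1H : C1H rho f) (f0 : f 0 = 0)
    (Xf0 : Xder f 0 != 0)
    (U : set (heis R)) (U_nbhs : nbhs (0 : heis R) U)
    (XfU : forall A, U A -> Xder f A != 0)
    (Omega : set (plane R)) (Omega_open : open Omega)
    (phi : plane R -> R) (phi_cont : {within Omega, continuous phi})
    (graphE : f @^-1` [set 0] `&` U = graph_map phi @` Omega)
    (graph_homeo :
       homeomorphism_onto Omega (f @^-1` [set 0] `&` U) (graph_map phi))
    (Omega' : set (plane R)) (Omega'_sub : compactly_contained Omega' Omega) :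
  forall eps : R, 0 < eps -> exists2 delta : R, 0 < delta &
    forall A B : plane R,
      dg_domain rho phi (graph_slope f phi) Omega Omega' (A, B) ->
      `|A - B| < delta ->
      forall d : R, is_dg rho phi (graph_slope f phi) Omega A B d ->
        `|d - dtilde rho phi A B| <= eps * d.
Proof.
move=> eps eps0; have [cK KOm] := Omega'_sub.
have cphi A : Omega A -> {for A, continuous phi}.
  move=> OA; move: phi_cont; rewrite continuous_open_subspace // => cp.
  exact: cp (mem_set OA).
have graphP A : Omega A -> f (graph_map phi A) = 0 /\ Xder f (graph_map phi A) != 0.
  move=> OA; have : (graph_map phi @` Omega) (graph_map phi A) by exists A.
  by rewrite -graphE => -[? /XfU].
have cphiK A : closure Omega' A -> {for A, continuous phi} by move=> /KOm; exact: cphi.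
have X0 A : closure Omega' A -> Xder f (graph_map phi A) != 0.
  by move=> /KOm /graphP[].
(* The second point ranges over [Omega], since integral curves may leave the closure of [Omega']. *)
have phi_diff (e : R) : 0 < e -> exists2 r : R, 0 < r &
    forall A B, closure Omega' A -> Omega B -> `|A - B| < r ->
    `|phi B - phi A - graph_slope f phi A * (B.1 - A.1)| <=
      e * hgauge (graph_diff phi A B).
  move=> e0.
  have [r r0 fr] := intrinsic_differentiability rho_norm f_C1H cK cphiK X0 e0.
  by exists r => // A B KA OB; apply: fr => //; apply: (graphP _ _).1 => //; exact: KOm.
have [M M0 wM] := graph_slope_bounded rho_norm f_C1H cK cphiK X0.
have [c c0 gauge_rho] := hgauge_le_hnorm rho_norm.
(* The error will first be bounded by k times [dtilde]: 1/2 gives that [dtilde] is at most 2d, and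
   eps/2 compensates this factor 2. *)
pose k := Num.min (1 / 2) (eps / 2).
have [k0 k2 keps] : [/\ 0 < k, k <= 1 / 2 & k <= eps / 2].
  by rewrite /k lt_min !ge_min !lexx orbT; split=> //; apply/andP; split; lra.
have kc : 0 < k / c by rewrite divr_gt0.
have [e e0 rho_e] := hnorm_perturbation rho_norm kc.
(* The vertical error below is a sum of three terms of weights 1, 2 and 2. *)
have e5 : 0 < e / 5 by lra.
have [r r0 pr] := phi_diff _ e5.
have [r' r'0 pr'] := half_curve_expansion cK KOm cphi phi_diff wM e5.
exists (Num.min r r') => [|A B [/= OA OB _]]; first by rewrite lt_min r0.
rewrite lt_min => /andP[ABr ABr'] d [I [g [[gI _] [_ gA] hI ->]]].
have KA : closure Omega' A by exact: subset_closure.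
have KB : closure Omega' B by exact: subset_closure.
have [sg [sg1 sgh hz zE]] := integral_curve_half gI gA hI.
set h := B.1 - A.1 in sgh hz zE hI *.
have hAB : `|h| <= `|A - B| by rewrite /h distrC; exact: (plane_norm_ge (A - B)).1.
have hH : 0 <= `|h| <= `|h| by rewrite normr_ge0 lexx.
have hr' : 0 <= `|h| < r' by rewrite normr_ge0 (le_lt_trans hAB).
have hO s : 0 <= s <= `|h| -> Omega (A.1 + sg * s, (g (sg * s)).2).
  by move=> sH; have [<-] := zE s sH.
have := pr' A sg `|h| (fun s => (g (sg * s)).2) KA sg1 hr' (conj hz hO).
rewrite sgh; set zh := (g h).2; set pC := phi (A.1 + h, zh) => -[hC1].
rewrite graph_diffE /= -/pC => hC2.
have := pr A B KA (KOm _ KB) ABr; rewrite -/h.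
set w := graph_slope f phi A in hC1 *; set V := graph_diff phi A B => hB.
have VE : V = (phi B - phi A, h, B.2 - A.2 + 2 * ((phi A + phi B) * h)).
  exact: graph_diffE.
have V1 : V.1.1 = phi B - phi A by rewrite VE.
have V2 : V.1.2 = h by rewrite VE.
have V3 : V.2 = B.2 - A.2 + 2 * ((phi A + phi B) * h) by rewrite VE.
have [_ hV _] := hgauge_coords V; rewrite V2 in hV.
set N := hgauge V in hV hB *; have N0 : 0 <= N by exact: hgauge_ge0.
have eN : e / 5 * N <= e * N by rewrite ler_wpM2r //; lra.
have e50 : 0 <= e / 5 by lra.
have := rho_e V (w * h, h, B.2 - zh).
rewrite -/N V1 V2 V3 /= subrr normr0.
move=> /(_ (le_trans hB eN) (mulr_ge0 (ltW e0) N0)) close.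
have {close} : `|rho V - rho (w * h, h, B.2 - zh)| <= k / c * N.
  apply: close.
  (* The first two summands form the vertical component at the curve point above [B.1]; the others
     replace [phi] there by [phi B], both values being compared with [phi A + w * h]. *)
  have -> : B.2 - A.2 + 2 * ((phi A + phi B) * h) - (B.2 - zh) =
      zh - A.2 + 2 * ((phi A + pC) * (A.1 + h - A.1)) +
      2 * ((phi B - phi A - w * h) * h) - 2 * ((pC - phi A - w * h) * h) by ring.
  have hh : `|h| * `|h| <= N * N by rewrite ler_pM.
  have b1 : e / 5 * `|h| ^+ 2 <= e / 5 * (N * N) by rewrite expr2 ler_wpM2l.
  have b2 : `|2 * ((phi B - phi A - w * h) * h)| <= 2 * (e / 5 * (N * N)).
    by rewrite normrM (@ger0_norm _ 2) // ler_pM2l // normrM mulrA ler_pM.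
  have b3 : `|2 * ((pC - phi A - w * h) * h)| <= 2 * (e / 5 * (N * N)).
    rewrite normrM (@ger0_norm _ 2) // ler_pM2l // normrM mulrA ler_pM //.
    by apply: le_trans hC1 _; rewrite ler_wpM2l.
  apply: le_trans (ler_normB _ _) _; apply: le_trans (lerD (ler_normD _ _) b3) _.
  have := lerD (lerD (le_trans hC2 b1) b2) (lexx (2 * (e / 5 * (N * N)))).
  by move=> /le_trans; apply; rewrite le_eqVlt; apply/orP; left; apply/eqP; field.
(* The constant [c] trades the gauge for [rho], making the error relative to [dtilde]. *)
have : k / c * N <= k * rho V.
  by rewrite -mulrA ler_pM2l // ler_pdivrMl // /N.
rewrite -[dtilde _ _ _ _]/(rho V); have := hnorm_ge0 rho_norm V.
move: (rho V) (rho (w * h, h, B.2 - zh)) (k / c * N) => x y z x0 hz1 hz2.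
have {hz1 hz2} : `|x - y| <= k * x by exact: le_trans hz2 hz1.
rewrite distrC => hq; apply: (le_trans hq).
have kx : k * x <= x / 2 by rewrite mulrC ler_wpM2l //; lra.
have xy : x <= 2 * y by move: hq; rewrite ler_norml => /andP[hq _]; lra.
apply: (le_trans (ler_wpM2r x0 keps)).
by rewrite mulrAC -mulrA ler_pM2l // ler_pdivrMr // mulrC.
Qed.
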